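(* Let $\mathbb G=(\mathsf A,u)$ be a PW-quantum group of dimension $3$ related to the array $E$. Let $l\neq n$ in $\{1,2,3\}$ and let $j$ be the third index, so $\{j,l,n\}=\{1,2,3\}$. For $r\neq k$ in $\{1,2,3\}$, let $i$ denote the third index, so $\{i,r,k\}=\{1,2,3\}$. Then the generators satisfy the following relations. (a) If $c_l^{(n)}\neq1$, then $$u_{an}u_{al}=0\quad\text{and}\quad u_{la}u_{na}=0\qquad(a=1,2,3),$$ and for $r\neq k$ $$u_{rn}u_{kl}=\frac{E_{irk}}{E_{ikr}}\frac{E_{jln}}{E_{jnl}}\,\frac{1-c_k^{(r)}}{1-c_l^{(n)}}\,u_{kl}u_{rn}+\frac{E_{irk}}{E_{ikr}}\,\frac{1-c_k^{(r)}c_l^{(n)}}{1-c_l^{(n)}}\,u_{kn}u_{rl}.$$ (b) If $c_l^{(n)}=1$, then for $a=1,2,3$ $$u_{an}u_{al}=-\frac{E_{jln}}{E_{jnl}}\,u_{al}u_{an},\qquad u_{na}u_{la}=-\frac{\overline{E_{jln}}}{\overline{E_{jnl}}}\,u_{la}u_{na},$$ and for $r\neq k$ $$u_{rn}u_{kl}=\frac{E_{irk}}{E_{ikr}}\frac{E_{jln}}{E_{jnl}}\left(1+c_k^{(r)}\Big|\frac{E_{ikr}}{E_{irk}}\Big|^2\right)\left(1+\Big|\frac{E_{jln}}{E_{jnl}}\Big|^2\right)^{-1}u_{kl}u_{rn}+\frac{E_{irk}}{E_{ikr}}\left(1-c_k^{(r)}\Big|\frac{E_{jln}}{E_{jnl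}}\Big|^2\Big|\frac{E_{ikr}}{E_{irk}}\Big|^2\right)\left(1+\Big|\frac{E_{jln}}{E_{jnl}}\Big|^2\right)^{-1}u_{kn}u_{rl}.$$
   Context: PW-quantum groups: let $E=[E_{i_1i_2i_3}]_{i_1,i_2,i_3=1}^3$ be an array of complex numbers with $E_{i_1i_2i_3}\neq0$ if and only if $(i_1,i_2,i_3)$ is a permutation of $(1,2,3)$. The PW-quantum group related to $E$ is $(\mathsf A,u)$, where $\mathsf A$ is the universal unital C$^*$-algebra generated by the entries of $u=[u_{jk}]_{j,k=1}^3$ subject to $\sum_{s}u_{js}u_{ks}^*=\delta_{jk}1=\sum_s u_{sj}^*u_{sk}$ and $\sum_{i_1,i_2,i_3}E_{i_1i_2i_3}u_{a_1i_1}u_{a_2i_2}u_{a_3i_3}=E_{a_1a_2a_3}1$ for all $a_1,a_2,a_3$, with comultiplication $\Delta(u_{jk})=\sum_s u_{js}\otimes u_{sk}$. Characteristic constants of $E$: for $l\neq n$, $c_l^{(n)}=\frac{E_{jln}}{E_{jnl}}\frac{E_{nlj}}{E_{lnj}}$, where $j$ is the unique index with $\{j,l,n\}=\{1,2,3\}$. *)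

(* Defs.v *)
From HB Require Import structures.
From mathcomp Require Import all_boot all_order all_algebra.
From mathcomp Require Import all_classical all_reals all_analysis.
From mathcomp Require Import complex.

Set Implicit Arguments.
Unset Strict Implicit.
Unset Printing Implicit Defensive.

Import Order.TTheory GRing.Theory Num.Theory.
Import numFieldNormedType.Exports.

Local Open Scope classical_set_scope.
Local Open Scope ring_scope.

(* Unital C*-algebras over the complex numbers [R[i]].  As everywhere in the
   MathComp hierarchy, [1 != 0].  The topology is described by sequences,
   because the norm of a [normedModType R[i]] would be [R[i]]-valued and that
   structure has no common refinement with [algType] in the library. *)
HB.mixin Record Algebra_isCStar (R : realType) A of GRing.Algebra R[i] A := {
  star : A -> A ;
  cnorm : A -> R ;
  starK : involutive star ;
  starD : forall x y, star (x + y) = star x + star y ;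
  starZ : forall (c : R[i]) x, star (c *: x) = c^* *: star x ;
  starM : forall x y, star (x * y) = star y * star x ;
  cnorm0_eq0 : forall x, cnorm x = 0 -> x = 0 ;
  ler_cnormD : forall x y, cnorm (x + y) <= cnorm x + cnorm y ;
  cnormZ : forall (c : R[i]) x, cnorm (c *: x) = complex.Re `|c| * cnorm x ;
  ler_cnormM : forall x y, cnorm (x * y) <= cnorm x * cnorm y ;
  cnorm_star_mul : forall x, cnorm (star x * x) = cnorm x ^+ 2 ;
  cnorm_complete : forall x : nat -> A,
    (forall e : R, 0 < e -> exists N : nat, forall m n : nat,
       (N <= m)%N -> (N <= n)%N -> cnorm (x m - x n) < e) ->
    exists y : A, (fun n => cnorm (x n - y)) @ \oo --> 0
}.

#[short(type="cstarAlgType")]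
HB.structure Definition CStarAlgebra (R : realType) :=
  {A of GRing.Algebra R[i] A & Algebra_isCStar R A}.

Definition star_preserving (R : realType) (A B : cstarAlgType R)
  (f : A -> B) : Prop := forall x, f (star x) = star (f x).

Definition cnorm_closed (R : realType) (A : cstarAlgType R) (V : set A) : Prop :=
  forall (x : nat -> A) (y : A), (forall n, V (x n)) ->
    (fun n => cnorm (x n - y)) @ \oo --> 0 -> V y.

(* [S] generates [A] as a unital C*-algebra. *)
Definition cstar_generates (R : realType) (A : cstarAlgType R)
    (S : set A) : Prop :=
  forall V : set A, cnorm_closed V -> S `<=` V -> V 1 ->
    (forall x y, V x -> V y -> V (x + y)) ->
    (forall (c : R[i]) x, V x -> V (c *: x)) ->
    (forall x y, V x -> V y -> V (x * y)) ->
    (forall x, V x -> V (star x)) ->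
  V = setT.

Section MinimalTensor.
Variable R : realType.

(* [a (x) b |-> f a * g b] is an injective unital *-homomorphism from the
   algebraic tensor product of [A] and [B] to [T]; in other words, the norm
   of [T] induces a C*-norm on that algebraic tensor product. *)
Definition cstar_norm_tensor (A B T : cstarAlgType R)
    (f : {lrmorphism A -> T}) (g : {lrmorphism B -> T}) : Prop :=
  [/\ star_preserving f, star_preserving g,
      forall a b, f a * g b = g b * f a
    & forall (n : nat) (a : 'I_n -> A) (b : 'I_n -> B),
        (forall c : 'I_n -> R[i], \sum_(s < n) c s *: a s = 0 ->
           forall s, c s = 0) ->
        \sum_(s < n) f (a s) * g (b s) = 0 -> forall s, b s = 0].

(* [T] is the completion of the algebraic tensor product in the least
   C*-norm, i.e. the minimal (spatial) tensor product of [A] and [B]. *)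
Definition min_tensor (A B T : cstarAlgType R)
    (f : {lrmorphism A -> T}) (g : {lrmorphism B -> T}) : Prop :=
  [/\ cstar_norm_tensor f g,
      forall V : set T, cnorm_closed V ->
        (forall a b, V (f a * g b)) ->
        (forall x y, V x -> V y -> V (x + y)) -> V = setT
    & forall (T' : cstarAlgType R)
             (f' : {lrmorphism A -> T'}) (g' : {lrmorphism B -> T'}),
        cstar_norm_tensor f' g' ->
        forall (n : nat) (a : 'I_n -> A) (b : 'I_n -> B),
          cnorm (\sum_(s < n) f (a s) * g (b s)) <=
          cnorm (\sum_(s < n) f' (a s) * g' (b s)) ].

End MinimalTensor.

(* The indices 1, 2, 3 are the elements of ['I_3]. *)
Definition array3 (T : Type) := 'I_3 -> 'I_3 -> 'I_3 -> T.

Definition pw_array (R : realType) (E : array3 R[i]) : Prop :=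
  forall i1 i2 i3 : 'I_3,
    E i1 i2 i3 != 0 <-> perm_eq [:: i1; i2; i3] (enum 'I_3).

Definition pw_relations (R : realType) (E : array3 R[i])
    (A : cstarAlgType R) (u : 'M[A]_3) : Prop :=
  [/\ forall j k, \sum_s u j s * star (u k s) = (j == k)%:R,
      forall j k, \sum_s star (u s j) * u s k = (j == k)%:R
    & forall a1 a2 a3,
        \sum_i1 \sum_i2 \sum_i3 E i1 i2 i3 *: (u a1 i1 * u a2 i2 * u a3 i3)
        = E a1 a2 a3 *: 1].

Record pw_quantum_group (R : realType) (E : array3 R[i]) := PWQuantumGroup {
  pw_alg : cstarAlgType R ;
  pw_gen : 'M[pw_alg]_3 ;
  pw_gen_rel : pw_relations E pw_gen ;
  pw_generates : cstar_generates [set x | exists j k, x = pw_gen j k] ;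
  (* The morphism is unique, because the entries of [pw_gen] generate. *)
  pw_universal : forall (B : cstarAlgType R) (v : 'M[B]_3), pw_relations E v ->
    exists2 f : {lrmorphism pw_alg -> B},
      star_preserving f & forall j k, f (pw_gen j k) = v j k ;
  pw_tensor : cstarAlgType R ;
  pw_inl : {lrmorphism pw_alg -> pw_tensor} ;
  pw_inr : {lrmorphism pw_alg -> pw_tensor} ;
  pw_tensorP : min_tensor pw_inl pw_inr ;
  pw_comul : {lrmorphism pw_alg -> pw_tensor} ;
  pw_comul_star : star_preserving pw_comul ;
  pw_comul_gen : forall j k, pw_comul (pw_gen j k) =
    \sum_s pw_inl (pw_gen j s) * pw_inr (pw_gen s k)
}.

(* The index [j] with [{j, l, n} = {1, 2, 3}]; a junk value if [l = n]. *)
Definition third (l n : 'I_3) : 'I_3 :=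
  odflt l [pick j | [set j; l; n]%SET == [set: 'I_3]%SET].

Lemma thirdP (j l n : 'I_3) : [set j; l; n]%SET = [set: 'I_3]%SET -> third l n = j.
Proof.
have in3 a b c d : [set a; b; c]%SET = [set: 'I_3]%SET -> d \in [:: a; b; c].
  by move=> h; have := finset.in_setT d; rewrite -h !inE -orbA.
have un3 a b c : [set a; b; c]%SET = [set: 'I_3]%SET -> uniq [:: a; b; c].
  move=> h; rewrite (@leq_size_uniq _ (enum 'I_3)) ?enum_uniq //.
    by move=> x _; exact: in3 h.
  by rewrite size_enum_ord.
move=> hj; rewrite /third; case: pickP => [k /eqP hk|/(_ j)]; last by rewrite hj eqxx.
have := in3 _ _ _ k hj; have := un3 _ _ _ hk.
by rewrite /= !inE negb_or => /andP[/andP[/negPf-> /negPf->] _]; rewrite !orbF => /eqP.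
Qed.

(* [char_const E l n] is the characteristic constant c_l^(n) of [E]. *)
Definition char_const (R : realType) (E : array3 R[i]) (l n : 'I_3) : R[i] :=
  let j := third l n in (E j l n / E j n l) * (E n l j / E l n j).

(* Main.v *)
Require Import Defs.
From HB Require Import structures.
From mathcomp Require Import all_boot all_order all_algebra.
From mathcomp Require Import all_classical all_reals all_analysis.
From mathcomp Require Import complex.
From mathcomp Require Import ring.

Set Implicit Arguments.
Unset Strict Implicit.
Unset Printing Implicit Defensive.

Import Order.TTheory GRing.Theory Num.Theory.
Import numFieldNormedType.Exports.

Local Open Scope ring_scope.

(** The cubic relation says that [u] fixes the tensor [E].  Cancelling one leg
    of it with an inverse of [u] turns it into quadratic relations: a
    combination of products [u_rp u_kq] equals a multiple of a single entry of
    that inverse.  As [E] is supported on permutations, each such relation has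
    only two products on the left, and it is [0] on the right for two products
    taken from one row.

    Four families of this kind are available.  The first leg of [u] is cancelled
    with the adjoint, since [u^* u = 1].  Moreover the conjugate array is fixed
    by the transpose of [u], because [u (x) u (x) u] is an isometry fixing [E]
    ([fixes_array_conj]), and the third leg of the transpose is again cancelled
    with the adjoint, since [u u^* = 1].  The other two legs need one-sided
    inverses of the transpose of [u] that unitarity does not give.  They come
    from invariance itself: the quadratic minors of a matrix that fixes a
    permutation-supported array are, up to scalars, the entries of such an
    inverse ([fixes_array_right_inverse], [fixes_array_left_inverse]).

    Exchanging the two rows in a relation only changes the scalar in front of the
    entry of the inverse, so that entry can be eliminated; what remains are the
    linear relations of [minor_relations] among the four products of entries
    in rows [r], [k] and columns [l], [n].  The rest is linear algebra.  If
    [c_l^(n) != 1], the relations from the first and from the third leg are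
    independent.  If [c_l^(n) = 1] they are not, and the relations from the
    first leg of [u] and of its transpose are used instead, whose determinant
    is a sum of two squared moduli.  The formula obtained in this way has no
    factor [c_k^(r)]: it is the stated one when [c_k^(r) = 1], and when
    [c_k^(r) != 1 = c_l^(n)] the four families together force all the
    products to vanish ([minors_eq0]), so that the stated one is [0 = 0]. *)

(** * Triples of indices and permutation-supported arrays *)

Lemma uniq3_perm (i r k : 'I_3) : uniq [:: i; r; k] -> perm_eq [:: i; r; k] (enum 'I_3).
Proof.
move=> h; apply: uniq_perm => //; first exact: enum_uniq.
apply: (uniq_min_size h _ _).2; last by rewrite size_enum_ord.
by move=> t _; rewrite mem_enum.
Qed.

Lemma sum_I3 (V : nmodType) (i r k : 'I_3) (f : 'I_3 -> V) :
  uniq [:: i; r; k] -> \sum_t f t = f i + f r + f k.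
Proof.
move=> h; rewrite -(big_enum _ _ _ f) -(perm_big _ (uniq3_perm h)).
by rewrite /= !big_cons big_nil addr0 addrA.
Qed.

Lemma set3_uniq (i r k : 'I_3) :
  [set i; r; k]%SET = [set: 'I_3]%SET -> uniq [:: i; r; k].
Proof.
move=> h; rewrite (@leq_size_uniq _ (enum 'I_3)) ?enum_uniq //.
  by move=> x _; have := finset.in_setT x; rewrite -h !inE -orbA.
by rewrite size_enum_ord.
Qed.

Definition perm_supported (K : fieldType) (F : array3 K) :=
  forall i r k : 'I_3, (F i r k != 0) = uniq [:: i; r; k].

Lemma pw_array_supported (R : realType) (E : array3 R[i]) :
  pw_array E -> perm_supported E.
Proof.
move=> hE i r k; apply/idP/idP => [/hE hp|hu].
  by rewrite (perm_uniq hp) enum_uniq.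
by apply/hE; exact: uniq3_perm.
Qed.

(** * Matrices fixing a permutation-supported array *)

Section Invariant.
Variables (K : fieldType) (A : algType K).
Implicit Types (F : array3 K) (v X Y : 'M[A]_3).

Definition fixes_array F v := forall a b c,
  \sum_i \sum_p \sum_q F i p q *: (v a i * v b p * v c q) = F a b c *: 1.

(** The condition [X^T *m v = 1] is kept in this transposed form because the
    entries of the inverse then carry the same row and column indices as those
    of [v], as the entrywise adjoint of a unitary matrix does.  Over a
    noncommutative ring it says nothing about [v^T *m X], hence the separate
    hypothesis of [contract_right]. *)
Lemma contract_left v X (f g : 'I_3 -> A) : X^T *m v = 1%:M ->
  (forall a, \sum_i v a i * f i = g a) ->
  forall s, f s = \sum_a X a s * g a.
Proof.
move=> hX hf s.
have hm : v *m (\col_i f i) = \col_i g i.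
  apply/matrixP => a z; rewrite !mxE -hf.
  by apply: eq_bigr => i _; rewrite mxE.
have := congr1 (mulmx X^T) hm; rewrite mulmxA hX mul1mx.
move/matrixP/(_ s 0); rewrite !mxE => ->.
by apply: eq_bigr => i _; rewrite !mxE.
Qed.

Lemma contract_right v Y (f g : 'I_3 -> A) : v^T *m Y = 1%:M ->
  (forall a, \sum_i f i * v a i = g a) ->
  forall s, f s = \sum_a g a * Y a s.
Proof.
move=> hY hf s.
have hm : (\row_i f i) *m v^T = \row_i g i.
  apply/matrixP => z a; rewrite !mxE -hf.
  by apply: eq_bigr => i _; rewrite !mxE.
have := congr1 (mulmx^~ Y) hm; rewrite -mulmxA hY mulmx1.
move/matrixP/(_ 0 s); rewrite !mxE => ->.
by apply: eq_bigr => i _; rewrite !mxE.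
Qed.

Lemma fixes_array_left F v a b c : fixes_array F v ->
  \sum_i v a i * (\sum_p \sum_q F i p q *: (v b p * v c q)) = F a b c *: 1.
Proof.
move=> <-; apply: eq_bigr => i _; rewrite mulr_sumr; apply: eq_bigr => p _.
by rewrite mulr_sumr; apply: eq_bigr => q _; rewrite -scalerAr mulrA.
Qed.

Lemma fixes_array_right F v a b c : fixes_array F v ->
  \sum_q (\sum_i \sum_p F i p q *: (v a i * v b p)) * v c q = F a b c *: 1.
Proof.
move=> <-; under eq_bigr do rewrite mulr_suml.
rewrite exchange_big; apply: eq_bigr => i _.
under eq_bigr do rewrite mulr_suml.
rewrite exchange_big; apply: eq_bigr => p _.
by apply: eq_bigr => q _; rewrite -scalerAl.
Qed.

Lemma contract_first_leg F v X : fixes_array F v -> X^T *m v = 1%:M ->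
  forall s a b, \sum_p \sum_q F s p q *: (v a p * v b q)
    = \sum_t F t a b *: X t s.
Proof.
move=> hF hX s a b.
rewrite (contract_left hX (f := fun s => \sum_p \sum_q F s p q *: (v a p * v b q))
  (fun t => fixes_array_left t a b hF)).
by apply: eq_bigr => t _; rewrite -scalerAr mulr1.
Qed.

Lemma contract_third_leg F v Y : fixes_array F v -> v^T *m Y = 1%:M ->
  forall s a b, \sum_p \sum_q F p q s *: (v a p * v b q)
    = \sum_t F a b t *: Y t s.
Proof.
move=> hF hY s a b.
rewrite (contract_right hY (f := fun s => \sum_p \sum_q F p q s *: (v a p * v b q))
  (fun t => fixes_array_right a b t hF)).
by apply: eq_bigr => t _; rewrite -scalerAl mul1r.
Qed.

(** With [b] and [c] fixed, invariance reads [v *m m = F _ b c] for the column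
    [m] of contracted minors of the rows [b] and [c].  If [a], [b], [c] are
    distinct, the right-hand side is a nonzero multiple of the [a]-th basis
    vector, so [m] is a multiple of the [a]-th column of a right inverse. *)
Lemma fixes_array_right_inverse F v : perm_supported F -> fixes_array F v ->
  exists Y, v *m Y = 1%:M.
Proof.
move=> hs hF.
(* Addition in ['I_3] is modulo 3, so [a], [a + 1], [a + 2] are distinct. *)
exists (\matrix_(i, a) ((F a (a + 1) (a + 2%:R))^-1 *:
  \sum_p \sum_q F i p q *: (v (a + 1) p * v (a + 2%:R) q))).
apply/matrixP => a b; rewrite !mxE.
under eq_bigr do rewrite mxE -scalerAr.
rewrite -scaler_sumr fixes_array_left // scalerA.
have := hs a (b + 1) (b + 2%:R); have := hs b (b + 1) (b + 2%:R).
case: (eqVneq a b) => [->|ne]; last first.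
  move=> _ h; suff /negbFE/eqP-> : (F a (b + 1) (b + 2%:R) != 0) = false.
    by rewrite mulr0 scale0r.
  rewrite h; move: a b ne {h}.
  by case=> [[|[|[|]]]] // ?; case=> [[|[|[|]]]].
have -> : uniq [:: b; b + 1; b + 2%:R] by case: b => [[|[|[|]]]].
by move=> h _; rewrite mulVf // scale1r.
Qed.

(** Here the minors of the first two rows form a row multiplied by [v^T]. *)
Lemma fixes_array_left_inverse F v : perm_supported F -> fixes_array F v ->
  exists Z, Z *m v^T = 1%:M.
Proof.
move=> hs hF.
exists (\matrix_(a, i) ((F (a + 1) (a + 2%:R) a)^-1 *:
  \sum_p \sum_q F p q i *: (v (a + 1) p * v (a + 2%:R) q))).
apply/matrixP => b a; rewrite !mxE.
under eq_bigr do rewrite !mxE -scalerAl.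
rewrite -scaler_sumr fixes_array_right // scalerA.
have := hs (b + 1) (b + 2%:R) a; have := hs (b + 1) (b + 2%:R) b.
case: (eqVneq b a) => [->|ne]; last first.
  move=> _ h; suff /negbFE/eqP-> : (F (b + 1) (b + 2%:R) a != 0) = false.
    by rewrite mulr0 scale0r.
  rewrite h; move: a b ne {h}.
  by case=> [[|[|[|]]]] // ?; case=> [[|[|[|]]]].
have -> : uniq [:: a + 1; a + 2%:R; a] by case: a => [[|[|[|]]]].
by move=> h _; rewrite mulVf // scale1r.
Qed.

Lemma sum_supported_first F (f : 'I_3 -> 'I_3 -> A) j l n :
  perm_supported F -> uniq [:: j; l; n] ->
  \sum_p \sum_q F j p q *: f p q = F j l n *: f l n + F j n l *: f n l.
Proof.
move=> hs hu.
have z a b c : ~~ uniq [:: a; b; c] -> F a b c = 0.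
  by rewrite -hs => /negbNE/eqP.
rewrite (sum_I3 _ hu) !(sum_I3 _ hu).
rewrite (z j j j) ?(z j j l) ?(z j j n) ?(z j l j) ?(z j l l) ?(z j n j)
  ?(z j n n) ?scale0r ?addr0 ?add0r //; by rewrite /= !inE ?eqxx ?orbT ?andbF.
Qed.

Lemma sum_supported_last F (f : 'I_3 -> 'I_3 -> A) j l n :
  perm_supported F -> uniq [:: j; l; n] ->
  \sum_p \sum_q F p q j *: f p q = F l n j *: f l n + F n l j *: f n l.
Proof.
move=> hs hu.
have z a b c : ~~ uniq [:: a; b; c] -> F a b c = 0.
  by rewrite -hs => /negbNE/eqP.
rewrite (sum_I3 _ hu) !(sum_I3 _ hu).
rewrite (z j j j) ?(z j l j) ?(z j n j) ?(z l j j) ?(z l l j) ?(z n j j)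
  ?(z n n j) ?scale0r ?addr0 ?add0r //; by rewrite /= !inE ?eqxx ?orbT ?andbF.
Qed.

(** What remains of the contracted invariance once the inverse of [v] is
    eliminated: the first and third clauses come from contracting the first
    leg, the other two from contracting the third leg. *)
Definition minor_relations F v := forall j l n i r k : 'I_3,
  uniq [:: j; l; n] -> uniq [:: i; r; k] ->
  [/\ forall a, F j l n *: (v a l * v a n) + F j n l *: (v a n * v a l) = 0,
      forall a, F l n j *: (v a l * v a n) + F n l j *: (v a n * v a l) = 0,
      F i k r *: (F j l n *: (v r l * v k n) + F j n l *: (v r n * v k l))
      = F i r k *: (F j l n *: (v k l * v r n) + F j n l *: (v k n * v r l))
    & F k r i *: (F l n j *: (v r l * v k n) + F n l j *: (v r n * v k l))
      = F r k i *: (F l n j *: (v k l * v r n) + F n l j *: (v k n * v r l))].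

Lemma fixes_array_minors F v X Y : perm_supported F -> fixes_array F v ->
  X^T *m v = 1%:M -> v^T *m Y = 1%:M -> minor_relations F v.
Proof.
move=> hs hF hX hY j l n i r k hj hi.
have z a b c : ~~ uniq [:: a; b; c] -> F a b c = 0.
  by rewrite -hs => /negbNE/eqP.
have hi' : uniq [:: i; k; r].
  by move: hi; rewrite (perm_uniq (s2 := [:: i; r; k])) // perm_cons (perm_catC [:: k] [:: r]).
have first a b := contract_first_leg hF hX j a b.
have third a b := contract_third_leg hF hY j a b.
split=> [a|a||].
- have := first a a; rewrite (sum_supported_first _ hs hj) => ->.
  by apply: big1 => t _; rewrite z ?scale0r //= !inE eqxx ?orbT ?andbF.
- have := third a a; rewrite (sum_supported_last _ hs hj) => ->.
  by apply: big1 => t _; rewrite z ?scale0r //= !inE eqxx ?orbT ?andbF.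
- have h a b : uniq [:: i; a; b] ->
    F j l n *: (v a l * v b n) + F j n l *: (v a n * v b l) = F i a b *: X i j.
    move=> hu; have := first a b; rewrite (sum_supported_first _ hs hj) => ->.
    rewrite (sum_I3 _ hu) (z a a b) ?(z b a b) ?scale0r ?addr0 //;
    by rewrite /= !inE eqxx ?orbT ?andbF.
  by rewrite !h // !scalerA mulrC.
- have h a b : uniq [:: i; a; b] ->
    F l n j *: (v a l * v b n) + F n l j *: (v a n * v b l) = F a b i *: Y i j.
    move=> hu; have := third a b; rewrite (sum_supported_last _ hs hj) => ->.
    rewrite (sum_I3 _ hu) (z a b a) ?(z a b b) ?scale0r ?addr0 //;
    by rewrite /= !inE eqxx ?orbT ?andbF.
  by rewrite !h // !scalerA mulrC.
Qed.

End Invariant.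

(** * Elimination in a vector space *)

Section LinearElimination.
Variables (K : fieldType) (V : lmodType K).
Implicit Types (x y z w : V).

Lemma cramer2 (p1 q1 p2 q2 : K) x y : p1 * q2 - p2 * q1 != 0 ->
  p1 *: x + q1 *: y = 0 -> p2 *: x + q2 *: y = 0 -> x = 0 /\ y = 0.
Proof.
move=> hD h1 h2; split; apply: (scalerI hD); rewrite scaler0.
- have : q2 *: (p1 *: x + q1 *: y) - q1 *: (p2 *: x + q2 *: y) = 0.
    by rewrite h1 h2 !scaler0 subr0.
  rewrite !scalerDr !scalerA [q2 * q1]mulrC opprD addrACA subrr addr0 -scalerBl.
  by rewrite ![_ * p1]mulrC [q1 * _]mulrC.
- have : p1 *: (p2 *: x + q2 *: y) - p2 *: (p1 *: x + q1 *: y) = 0.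
    by rewrite h1 h2 !scaler0 subr0.
  by rewrite !scalerDr !scalerA [p2 * p1]mulrC opprD addrACA subrr add0r -scalerBl.
Qed.

Lemma eliminate2 (p1 q1 r1 s1 p2 q2 r2 s2 al be : K) x y z w :
  p1 * q2 - p2 * q1 != 0 ->
  p1 *: x + q1 *: y = r1 *: z + s1 *: w ->
  p2 *: x + q2 *: y = r2 *: z + s2 *: w ->
  (p1 * q2 - p2 * q1) * al = p1 * r2 - p2 * r1 ->
  (p1 * q2 - p2 * q1) * be = p1 * s2 - p2 * s1 ->
  y = al *: z + be *: w.
Proof.
move=> hD h1 h2 hal hbe; apply: (scalerI hD).
rewrite scalerDr !scalerA hal hbe.
have : p1 *: (p2 *: x + q2 *: y) - p2 *: (p1 *: x + q1 *: y) =
       p1 *: (r2 *: z + s2 *: w) - p2 *: (r1 *: z + s1 *: w) by rewrite h1 h2.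
rewrite !scalerDr !scalerA [p2 * p1]mulrC opprD addrACA subrr add0r -scalerBl => ->.
by rewrite opprD addrACA -!scalerBl.
Qed.

End LinearElimination.

(** In this section [x1], ..., [x4] stand for [E_jln], [E_jnl], [E_lnj],
    [E_nlj], and [y1], ..., [y4] for [E_irk], [E_ikr], [E_rki], [E_kri]; the
    vectors [e], [a], [b], [d] are the products [u_rl u_kn], [u_rn u_kl],
    [u_kl u_rn], [u_kn u_rl], so that [c] is [c_l^(n)] and [c'] is [c_k^(r)].
    The hypotheses on rows come from [u] and [E], those on columns from the
    transpose and the conjugate array. *)
Section MinorElimination.
Variables (C : numClosedFieldType) (V : lmodType C).
Variables (x1 x2 x3 x4 y1 y2 y3 y4 : C) (e a b d : V).
Hypotheses (hx1 : x1 != 0) (hx2 : x2 != 0) (hx3 : x3 != 0) (hx4 : x4 != 0).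
Hypotheses (hy1 : y1 != 0) (hy2 : y2 != 0) (hy4 : y4 != 0).
Let c := x1 / x2 * (x4 / x3).
Let c' := y2 / y1 * (y3 / y4).
Hypothesis first_rows : y2 *: (x1 *: e + x2 *: a) = y1 *: (x1 *: b + x2 *: d).
Hypothesis third_rows : y4 *: (x3 *: e + x4 *: a) = y3 *: (x3 *: b + x4 *: d).
Hypothesis first_cols :
  x2^* *: (y1^* *: e + y2^* *: b) = x1^* *: (y1^* *: a + y2^* *: d).
Hypothesis third_cols :
  x4^* *: (y3^* *: e + y4^* *: b) = x3^* *: (y3^* *: a + y4^* *: d).

Lemma sqnormD_neq0 : x2 * x2^* + x1 * x1^* != 0.
Proof.
rewrite paddr_eq0 ?mul_conjC_ge0 // negb_and.
by rewrite mulf_neq0 // conjC_eq0.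
Qed.

(** The system in [e] and [a] formed by [first_rows] and [third_rows] has
    determinant zero exactly when [c = 1]. *)
Lemma minor_commutation_neq1 : c != 1 ->
  a = ((y1 / y2) * (x1 / x2) * ((1 - c') / (1 - c))) *: b
      + ((y1 / y2) * ((1 - c' * c) / (1 - c))) *: d.
Proof.
move=> hc.
have hD : x2 * x3 - x1 * x4 != 0.
  apply: contra hc; rewrite subr_eq0 => /eqP h; rewrite /c mulf_div -h divff //.
  by rewrite mulf_neq0.
move: first_rows third_rows; rewrite !scalerDr !scalerA => h1 h3.
apply: (eliminate2 (z := b) (w := d) _ h1 h3).
- rewrite (_ : _ - _ = - (y2 * y4 * (x2 * x3 - x1 * x4))); last by ring.
  by rewrite oppr_eq0 !mulf_neq0.
- by rewrite /c /c'; field; rewrite ?hD ?hx1 ?hx2 ?hx3 ?hy1 ?hy2 ?hy4.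
- by rewrite /c /c'; field; rewrite ?hD ?hx1 ?hx2 ?hx3 ?hy1 ?hy2 ?hy4.
Qed.

(** The system in [e] and [a] formed by [first_rows] and [first_cols] is always
    nonsingular: its determinant is a nonzero multiple of
    [`|x1| ^+ 2 + `|x2| ^+ 2]. *)
Lemma minor_commutation_sqnorm :
  a = ((y1 / y2) * (x1 / x2) * (1 + `|y2 / y1| ^+ 2)
        * (1 + `|x1 / x2| ^+ 2)^-1) *: b
      + ((y1 / y2) * (1 - `|x1 / x2| ^+ 2 * `|y2 / y1| ^+ 2)
        * (1 + `|x1 / x2| ^+ 2)^-1) *: d.
Proof.
rewrite !normCK !rmorphM !fmorphV /=.
have hN := sqnormD_neq0.
have [hx1' hx2' hy1' hy2'] : [/\ x1^* != 0, x2^* != 0, y1^* != 0 & y2^* != 0].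
  by rewrite !conjC_eq0.
have h2 : (x2^* * y1^*) *: e + (- (x1^* * y1^*)) *: a
    = (- (x2^* * y2^*)) *: b + (x1^* * y2^*) *: d.
  move: first_cols; rewrite !scalerDr !scalerA => /(canRL (addrK _)) ->.
  by rewrite !scaleNr addrAC [X in X - _ - _]addrC addrK addrC.
move: first_rows; rewrite !scalerDr !scalerA => h1.
apply: (eliminate2 (z := b) (w := d) _ h1 h2).
- rewrite (_ : _ - _ = - (y2 * y1^* * (x2 * x2^* + x1 * x1^*))); last by ring.
  by rewrite oppr_eq0 !mulf_neq0.
- by field; rewrite ?hN ?hx1 ?hx2 ?hx2' ?hy1 ?hy2 ?hy1'.
- by field; rewrite ?hN ?hx1 ?hx2 ?hx2' ?hy1 ?hy2 ?hy1'.
Qed.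

(** For [c = 1] the rows [(x1, x2)] and [(x3, x4)] are proportional, so both row
    relations concern the same two combinations [x1 e + x2 a] and
    [x1 b + x2 d]; [c' != 1] makes these relations independent and the
    combinations vanish.  In the same way the column relations kill
    [x2^* e - x1^* a] and [x2^* b - x1^* d], which are independent of the first
    two combinations because [`|x1| ^+ 2 + `|x2| ^+ 2] is nonzero. *)
Lemma minors_eq0 : c = 1 -> c' != 1 -> a = 0 /\ b = 0 /\ d = 0.
Proof.
move=> hc hc'.
have hx : x1 * x4 = x2 * x3.
  by rewrite -[RHS]mul1r -hc /c; field; rewrite ?hx2 ?hx3.
have hD : y2 * y3 - y1 * y4 != 0.
  apply: contra hc'; rewrite subr_eq0 => /eqP h; rewrite /c' mulf_div h divff //.
  by rewrite mulf_neq0.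
have [hx1' hx2' hx3' hx4'] : [/\ x1^* != 0, x2^* != 0, x3^* != 0 & x4^* != 0].
  by rewrite !conjC_eq0.
have hxJ : x1^* * x4^* = x2^* * x3^* by rewrite -!rmorphM hx.
have [hP hQ] : x1 *: e + x2 *: a = 0 /\ x1 *: b + x2 *: d = 0.
  apply: (@cramer2 _ _ y2 (- y1) y4 (- y3)).
  - by rewrite (_ : _ - _ = - (y2 * y3 - y1 * y4)) ?oppr_eq0 //; ring.
  - by rewrite scaleNr first_rows subrr.
  - apply: (scalerI hx3); rewrite scaler0 scaleNr scalerBr !scalerA.
    rewrite [x3 * y4]mulrC [x3 * y3]mulrC.
    have step y (s t : V) : (y * x3) *: (x1 *: s + x2 *: t)
        = x1 *: (y *: (x3 *: s + x4 *: t)).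
      rewrite !scalerDr !scalerA; congr (_ *: _ + _ *: _); first by ring.
      by rewrite -mulrA [x3 * x2]mulrC -hx; ring.
    by rewrite !step third_rows subrr.
have [hX hW] : x2^* *: e - x1^* *: a = 0 /\ x2^* *: b - x1^* *: d = 0.
  have split2 (p q s t : C) : p *: (s *: e + t *: b) = q *: (s *: a + t *: d) ->
      s *: (p *: e - q *: a) + t *: (p *: b - q *: d) = 0.
    move=> h; rewrite !scalerBr addrACA -opprD !scalerA ![_ * p]mulrC ![_ * q]mulrC.
    by rewrite -!scalerA -!scalerDr h subrr.
  apply: (@cramer2 _ _ y1^* y2^* y3^* y4^*).
  - rewrite -!rmorphM -rmorphB conjC_eq0.
    by rewrite (_ : _ - _ = - (y2 * y3 - y1 * y4)) ?oppr_eq0 //; ring.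
  - exact: split2.
  - apply: split2; apply: (scalerI hx4').
    rewrite ![x4^* *: (_ *: (_ + _))]scalerA [x4^* * x1^*]mulrC hxJ.
    by rewrite -[RHS]scalerA -third_cols scalerA mulrC.
have hN : x1 * - x1^* - x2^* * x2 != 0.
  rewrite (_ : _ - _ = - (x2 * x2^* + x1 * x1^*)) ?oppr_eq0 ?sqnormD_neq0 //.
  by ring.
rewrite -scaleNr in hX; rewrite -scaleNr in hW.
by have [_ ->] := cramer2 hN hP hX; have [-> ->] := cramer2 hN hQ hW.
Qed.

End MinorElimination.

(** * Duality for unitary matrices over a C*-algebra *)

Section Star.
Variables (R : realType) (A : cstarAlgType R).

Lemma star1 : star (1 : A) = 1.
Proof. by have := starM (1 : A) (star 1); rewrite mul1r !starK mul1r => <-. Qed.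

Lemma star0 : star (0 : A) = 0.
Proof. by rewrite -[0 in LHS](scale0r (0 : A)) starZ conjC0 scale0r. Qed.

Lemma star_sum (I : finType) (f : I -> A) :
  star (\sum_t f t) = \sum_t star (f t).
Proof. exact: (big_morph (@star R A) (@starD R A) star0). Qed.

(** Cancelling all three legs of [E = u u u E] with the adjoint expresses the
    scalar [E_spq] as a sum of triple products of adjoints in reversed order;
    taking the adjoint restores the order, conjugates [E], and leaves the sum
    running over the row indices. *)
Lemma fixes_array_conj (E : array3 R[i]) (u : 'M[A]_3) :
  (map_mx star u)^T *m u = 1%:M -> fixes_array E u ->
  fixes_array (fun a b c => (E a b c)^*) u^T.
Proof.
move=> hu hE s p q.
have h2 c : \sum_q E s p q *: u c q
    = \sum_b star (u b p) * (\sum_t E t b c *: star (u t s)).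
  rewrite (contract_left hu (f := fun p => \sum_q E s p q *: u c q)
    (g := fun b => \sum_t E t b c *: star (u t s))) => [|b].
    by apply: eq_bigr => b _; rewrite mxE.
  transitivity (\sum_t E t b c *: (map_mx star u) t s); last first.
    by apply: eq_bigr => t _; rewrite mxE.
  rewrite -(contract_first_leg hE hu); apply: eq_bigr => a _.
  by rewrite mulr_sumr; apply: eq_bigr => t _; rewrite -scalerAr.
have h3 : E s p q *: 1
    = \sum_c star (u c q) * (\sum_q E s p q *: u c q).
  rewrite (contract_left hu (f := fun q => E s p q *: 1)
    (g := fun c => \sum_q E s p q *: u c q)) => [|c].
    by apply: eq_bigr => c _; rewrite mxE.
  by apply: eq_bigr => t _; rewrite -scalerAr mulr1.
rewrite -[RHS]/((E s p q)^* *: 1) -star1 -starZ h3.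
rewrite star_sum; under [RHS]eq_bigr => c _.
  rewrite starM h2 starK star_sum mulr_suml; under eq_bigr => b _.
    rewrite starM starK star_sum !mulr_suml; under eq_bigr => t _.
      rewrite starZ starK -!scalerAl; over.
    over.
  over.
under eq_bigr do rewrite exchange_big.
rewrite exchange_big [RHS]exchange_big /=.
under [RHS]eq_bigr do rewrite exchange_big.
rewrite [RHS]exchange_big.
by apply: eq_bigr => t _; do 2![apply: eq_bigr => ? _]; rewrite !mxE.
Qed.

Lemma pw_minor_relations (E : array3 R[i]) (u : 'M[A]_3) :
  perm_supported E -> pw_relations E u ->
  minor_relations E u /\ minor_relations (fun a b c => (E a b c)^*) u^T.
Proof.
move=> hs [huu' hu'u hE].
have hX : (map_mx star u)^T *m u = 1%:M.
  apply/matrixP => j k; rewrite !mxE -hu'u.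
  by apply: eq_bigr => t _; rewrite !mxE.
have hY : u *m (map_mx star u)^T = 1%:M.
  apply/matrixP => j k; rewrite !mxE -huu'.
  by apply: eq_bigr => t _; rewrite !mxE.
have hE' := fixes_array_conj hX hE.
have hs' : perm_supported (fun a b c => (E a b c)^*).
  by move=> a b c; rewrite conjC_eq0 hs.
have [Y hY'] := fixes_array_right_inverse hs' hE'.
have [Z hZ] := fixes_array_left_inverse hs hE.
split; first exact: fixes_array_minors hs hE hX hY'.
apply: (fixes_array_minors (X := Z^T) (Y := (map_mx star u)^T)) hs' hE' _ _.
  by rewrite trmxK.
by rewrite trmxK.
Qed.

End Star.
(** * The commutation relations *)

Lemma char_constE (R : realType) (E : array3 R[i]) (j l n : 'I_3) :
  [set j; l; n]%SET = [set: 'I_3]%SET ->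
  char_const E l n = (E j l n / E j n l) * (E n l j / E l n j).
Proof. by move=> h; rewrite /char_const (thirdP h). Qed.

Theorem theorem4p1 (R : realType) (E : array3 R[i]) (hE : pw_array E)
    (G : pw_quantum_group E) (l n j : 'I_3) (hln : l != n)
    (hjln : [set j; l; n]%SET = [set: 'I_3]%SET) :
  let u := pw_gen G in
  let c := char_const E in
  (c l n != 1 ->
     (forall a : 'I_3, u a n * u a l = 0 /\ u l a * u n a = 0) /\
     (forall r k i : 'I_3, r != k -> [set i; r; k]%SET = [set: 'I_3]%SET ->
        u r n * u k l =
          ((E i r k / E i k r) * (E j l n / E j n l)
             * ((1 - c k r) / (1 - c l n))) *: (u k l * u r n)
          + ((E i r k / E i k r) * ((1 - c k r * c l n) / (1 - c l n)))
             *: (u k n * u r l)))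
  /\
  (c l n = 1 ->
     (forall a : 'I_3,
        u a n * u a l = - (E j l n / E j n l) *: (u a l * u a n) /\
        u n a * u l a = - ((E j l n)^* / (E j n l)^*) *: (u l a * u n a)) /\
     (forall r k i : 'I_3, r != k -> [set i; r; k]%SET = [set: 'I_3]%SET ->
        u r n * u k l =
          ((E i r k / E i k r) * (E j l n / E j n l)
             * (1 + c k r * `|E i k r / E i r k| ^+ 2)
             * (1 + `|E j l n / E j n l| ^+ 2)^-1) *: (u k l * u r n)
          + ((E i r k / E i k r)
             * (1 - c k r * `|E j l n / E j n l| ^+ 2 * `|E i k r / E i r k| ^+ 2)
             * (1 + `|E j l n / E j n l| ^+ 2)^-1) *: (u k n * u r l))).
Proof.
move=> u c.
have hs := pw_array_supported hE.
have [hrow hcol] := pw_minor_relations hs (pw_gen_rel G).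
have hj := set3_uniq hjln.
have nz i r k : [set i; r; k]%SET = [set: 'I_3]%SET ->
    [/\ E i r k != 0, E i k r != 0, E r k i != 0 & E k r i != 0].
  move/set3_uniq; rewrite !hs /= !inE !negb_or !andbT.
  case/andP => /andP[ir ik] rk.
  by rewrite ![k == _]eq_sym ![r == i]eq_sym ir ik rk.
have [x1 x2 x3 x4] := nz _ _ _ hjln.
have cE := char_constE E hjln.
have c'E r k i : [set i; r; k]%SET = [set: 'I_3]%SET ->
    c k r = (E i k r / E i r k) * (E r k i / E k r i).
  by move=> h; apply: char_constE; rewrite finset.setUAC.
have rows r k i (hirk : [set i; r; k]%SET = [set: 'I_3]%SET) :=
  hrow _ _ _ _ _ _ hj (set3_uniq hirk).
have cols r k i (hirk : [set i; r; k]%SET = [set: 'I_3]%SET) :=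
  hcol _ _ _ _ _ _ (set3_uniq hirk) hj.
have [row1 row3 _ _] := hrow _ _ _ _ _ _ hj hj.
have [col1 col3 _ _] := hcol _ _ _ _ _ _ hj hj.
split=> hc; split.
- have hD : E j l n * E n l j - E l n j * E j n l != 0.
    apply: contra hc; rewrite subr_eq0 => /eqP h.
    by rewrite /c cE mulf_div h [X in X / _]mulrC divff // mulf_neq0.
  move=> a; have [_ ->] := cramer2 hD (row1 a) (row3 a); split=> //.
  have := col1 a; have := col3 a; rewrite !mxE => h3 h1.
  have hD' : (E j l n)^* * (E n l j)^* - (E l n j)^* * (E j n l)^* != 0.
    by rewrite -!rmorphM -rmorphB conjC_eq0.
  by have [-> _] := cramer2 hD' h1 h3.
- move=> r k i _ hi; have [y1 y2 y3 y4] := nz _ _ _ hi.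
  have [_ _ h1 h3] := rows _ _ _ hi.
  rewrite (c'E _ _ _ hi) /c cE.
  by apply: minor_commutation_neq1 h1 h3 _ => //; rewrite -cE.
- have solve (p q : R[i]) (s t : pw_alg G) : q != 0 -> p *: s + q *: t = 0 ->
      t = - (p / q) *: s.
    move=> q0 /eqP; rewrite addrC addr_eq0 => /eqP h; apply: (scalerI q0).
    by rewrite h scalerA mulrN mulrCA divff // mulr1 scaleNr.
  move=> a; split; first exact: solve x2 (row1 a).
  by have := col1 a; rewrite !mxE => /solve -> //; rewrite conjC_eq0.
- move=> r k i _ hi; have [y1 y2 y3 y4] := nz _ _ _ hi.
  have [_ _ h1 h3] := rows _ _ _ hi.
  have [_ _] := cols _ _ _ hi; rewrite !mxE => h1' h3'.
  have [hc'|hc'] := eqVneq (c k r) 1.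
    by rewrite hc' !mul1r; exact: minor_commutation_sqnorm h1 h1'.
  have [] := minors_eq0 x1 x2 x3 x4 y1 y4 h1 h3 h1' h3' _ _.
  + by rewrite -cE.
  + by rewrite -c'E.
  by rewrite -/u => -> [-> ->]; rewrite !scaler0 addr0.
Qed.
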